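(* A real normed linear space $X$ is strictly convex if and only if for all $x, y \in S_X$, $x \perp_B y$ implies $x \perp_{SB} y$.
   Context: $S_X = \{x \in X : \|x\| = 1\}$ and $B_X = \{x \in X : \|x\| \le 1\}$. $X$ is strictly convex iff every element of $S_X$ is an extreme point of $B_X$. For $x, y \in X$: $x \perp_B y$ (Birkhoff-James orthogonality) iff $\|x\| \le \|x + \lambda y\|$ for all scalars $\lambda$; $x \perp_{SB} y$ (strong Birkhoff-James orthogonality) iff $\|x\| < \|x + \lambda y\|$ for all scalars $\lambda \ne 0$. *)

(* Defs.v *)
(* MathComp-Analysis: a real normed linear space is X : normedModType R with
   R : realType. *)
From mathcomp Require Import all_boot all_order all_algebra.
From mathcomp Require Import all_classical all_reals all_analysis.

Set Implicit Arguments.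
Unset Strict Implicit.
Unset Printing Implicit Defensive.

Import Order.TTheory GRing.Theory Num.Theory.
Import numFieldNormedType.Exports.

Local Open Scope classical_set_scope.
Local Open Scope ring_scope.

Definition unit_sphere (R : realType) (X : normedModType R) : set X :=
  [set x | `|x| = 1].
Arguments unit_sphere {R} X _.

Definition unit_ball (R : realType) (X : normedModType R) : set X :=
  [set x | `|x| <= 1].
Arguments unit_ball {R} X _.

Definition extreme_point (R : realType) (X : normedModType R)
    (A : set X) (x : X) : Prop :=
  A x /\
  forall (y z : X) (t : R), A y -> A z -> 0 < t < 1 ->
    x = (1 - t) *: y + t *: z -> y = x /\ z = x.

Definition strictly_convex (R : realType) (X : normedModType R) : Prop :=
  forall x : X, unit_sphere X x -> extreme_point (unit_ball X) x.

Definition birkhoff_orth (R : realType) (X : normedModType R) (x y : X) : Prop :=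
  forall lambda : R, `|x| <= `|x + lambda *: y|.

Definition strong_birkhoff_orth (R : realType) (X : normedModType R)
    (x y : X) : Prop :=
  forall lambda : R, lambda != 0 -> `|x| < `|x + lambda *: y|.

(* Main.v *)
(** If [x] in the unit sphere is a proper convex combination of [y] and [z] in
    the unit ball, then the convex function [s |-> |x + s (z - y)|] attains an
    interior maximum over the segment at [s = 0], hence a global minimum there:
    [x] is Birkhoff-James orthogonal to [z - y], and [z] lies on that line with
    norm at most 1, contradicting strong orthogonality unless [z = y].
    Conversely, if [|x + lambda y| = |x|] with [x] orthogonal to [y], then the
    midpoint [x + (lambda / 2) y] is a non-extreme point of the sphere. *)
Require Import Defs.
From mathcomp Require Import all_boot all_order all_algebra.
From mathcomp Require Import all_classical all_reals all_analysis.
From mathcomp Require Import lra.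

Set Implicit Arguments.
Unset Strict Implicit.
Unset Printing Implicit Defensive.

Import Order.TTheory GRing.Theory Num.Theory.
Import numFieldNormedType.Exports.

Local Open Scope ring_scope.

(** [x] is a convex combination of [x - a *: v] and [x + b *: v], the latter with positive weight
    [a / (a + b)], so they cannot have norms [<= 1] and [< 1] respectively. *)
Lemma norm_ge1_opposite_side (R : realType) (X : normedModType R) (x v : X)
    (a b : R) :
  `|x| = 1 -> 0 < a -> 0 <= b -> `|x - a *: v| <= 1 -> 1 <= `|x + b *: v|.
Proof.
move=> x1 a0 b0 xa1.
have Ex : (a + b) *: x = b *: (x - a *: v) + a *: (x + b *: v).
  rewrite scalerBr scalerDr !scalerA (mulrC b a) scalerDl.
  by rewrite addrACA addNr addr0 addrC.
have := ler_normD (b *: (x - a *: v)) (a *: (x + b *: v)).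
rewrite -Ex !normrZ x1 (ger0_norm b0) (gtr0_norm a0) ger0_norm; last lra.
have := ler_wpM2l b0 xa1.
rewrite !mulr1 => h1 h2.
have h3 : a * 1 <= a * `|x + b *: v| by lra.
by move: h3; rewrite ler_pM2l.
Qed.

Lemma birkhoff_orth_segment (R : realType) (X : normedModType R) (y z : X)
    (t : R) :
  unit_ball X y -> unit_ball X z -> 0 < t < 1 ->
  unit_sphere X (y + t *: (z - y)) ->
  birkhoff_orth (y + t *: (z - y)) (z - y).
Proof.
rewrite /unit_ball /unit_sphere /= => y1 z1 /andP[t0 t1] x1 l; rewrite x1.
(* The endpoint opposite to the direction of travel is used: [y] for [l >= 0], [z] for [l < 0]. *)
have [l0|l0] := leP 0 l.
  by apply: (norm_ge1_opposite_side x1 t0 l0); rewrite addrK.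
rewrite -[l *: _]opprK -scaleNr -scalerN.
apply: (@norm_ge1_opposite_side _ _ _ _ (1 - t)) => //; [lra|lra|].
by rewrite scalerN opprK -addrA -scalerDl [t + _]addrC subrK scale1r [y + _]addrC subrK.
Qed.

Theorem theorem2p4 (R : realType) (X : normedModType R) :
  strictly_convex X <->
  (forall x y : X, unit_sphere X x -> unit_sphere X y ->
     birkhoff_orth x y -> strong_birkhoff_orth x y).
Proof.
split=> [sc x y x1 y1 xy l l0|orth x x1].
  rewrite ltNge; apply/negP => xly.
  have Em : x + (l / 2) *: y = (1 - 2^-1) *: x + 2^-1 *: (x + l *: y).
    by rewrite scalerDr addrA -scalerDl subrK scale1r scalerA (mulrC l).
  rewrite /unit_sphere /= in x1 y1.
  (* Orthogonality bounds the norm below, convexity above. *)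
  have m1 : unit_sphere X (x + (l / 2) *: y).
    apply/eqP; rewrite eq_le; apply/andP; split; last by rewrite -[1]x1 xy.
    rewrite Em.
    apply: le_trans (ler_normD _ _) _.
    by rewrite !normrZ !ger0_norm; lra.
  have [_ ext] := sc _ m1.
  have [|||xm _] := ext x (x + l *: y) 2^-1 _ _ _ Em.
  - by rewrite /unit_ball /= x1.
  - by rewrite /unit_ball /= -x1.
  - lra.
  have /eqP : (l / 2) *: y = 0 by apply: (addrI x); rewrite addr0 -xm.
  rewrite -normr_eq0 normrZ y1 mulr1 normr_eq0 => /eqP l20.
  by move/eqP: l0; apply; lra.
split; first by rewrite /unit_ball /= x1.
move=> y z t y1 z1 t01 Ex.
have {}Ex : x = y + t *: (z - y).
  by rewrite Ex scalerBl scale1r scalerBr addrA addrAC.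
have [zy|zy] := eqVneq (z - y) 0.
  move: Ex; rewrite zy scaler0 addr0 => ->; split=> //.
  exact: subr0_eq.
have w0 : 0 < `|z - y| by rewrite normr_gt0.
have xw : birkhoff_orth x (z - y).
  by rewrite Ex; apply: birkhoff_orth_segment; rewrite // -Ex.
(* [orth] accepts only unit vectors, so the direction is normalised. *)
have u1 : unit_sphere X (`|z - y|^-1 *: (z - y)).
  by rewrite /unit_sphere /= normrZ gtr0_norm ?invr_gt0// mulVf ?gt_eqF.
have xu : birkhoff_orth x (`|z - y|^-1 *: (z - y)).
  by move=> l; rewrite scalerA; exact: xw.
have /andP[_ t1] := t01.
(* This multiple of the unit direction leads from [x] exactly to [z]. *)
have l0 : (1 - t) * `|z - y| != 0.
  by rewrite mulf_neq0 ?gt_eqF// subr_gt0.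
have := orth _ _ x1 u1 xu _ l0.
rewrite scalerA -mulrA divff ?gt_eqF// mulr1.
rewrite {2}Ex -addrA -scalerDl [t + _]addrC subrK scale1r [y + _]addrC subrK.
by rewrite x1 ltNge z1.
Qed.
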